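(* Let $p$ be a prime and let $d$ be a positive integer. There exist positive integers $u,v$ such that $\frac{4}{p}=\frac{1}{duv}+\frac{1}{dup}+\frac{1}{dvp}$ if and only if there exists a positive integer $n$ such that $p\equiv -n \pmod{4dn-1}$. Moreover, any such solution $(duv,dup,dvp)$ is of Type II.
   Context: For a positive integer $a$, a solution for $a$ is a triple of positive integers $(x,y,z)$ with $\frac{4}{a}=\frac1x+\frac1y+\frac1z$. A solution is of Type II if, after arranging its entries in nondecreasing order $x\le y\le z$, one has $\gcd(a,x)=1$ and $a\mid y$, $a\mid z$. A solution for $a$ of the form $(duv,dua,dva)$ with $d,u,v$ positive integers is called a Type B solution. *)

(* Defs.v *)
From mathcomp Require Import all_boot all_order all_algebra.
Set Implicit Arguments.
Unset Strict Implicit.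
Unset Printing Implicit Defensive.
Import Order.TTheory GRing.Theory Num.Theory.

Local Open Scope ring_scope.

Definition solution (a : nat) (t : nat * nat * nat) : Prop :=
  let: (x, y, z) := t in
  [/\ (0 < x)%N, (0 < y)%N, (0 < z)%N
    & 4 / a%:R = 1 / x%:R + 1 / y%:R + 1 / z%:R :> rat].

Definition typeII (a : nat) (t : nat * nat * nat) : Prop :=
  solution a t /\
  exists x y z : nat,
    [/\ perm_eq [:: x; y; z] [:: t.1.1; t.1.2; t.2],
        (x <= y <= z)%N,
        gcdn a x = 1%N,
        (a %| y)%N
      & (a %| z)%N].

(* Main.v *)
(**
Clearing denominators, the equation [4/p = 1/(duv) + 1/(dup) + 1/(dvp)] says
[4duv = p + u + v], that is [v (4du - 1) = p + u]: take [n = u] in one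
direction, and let [v] be the quotient of [p + n] by [4dn - 1] in the other.
If one of [d], [u], [v] were at least [p], then [p + u + v <= 3duv < 4duv];
hence all three are smaller than the prime [p], so [duv] is coprime to [p]
and is the least of the three denominators.
*)
Require Import Defs.
From mathcomp Require Import all_boot all_order all_algebra.
From mathcomp Require Import ring zify.
Import GRing.Theory Num.Theory.
Local Open Scope ring_scope.

Lemma typeB_equationE (p d u v : nat) :
  (0 < p)%N -> (0 < d)%N -> (0 < u)%N -> (0 < v)%N ->
  (4 / p%:R = 1 / (d * u * v)%:R + 1 / (d * u * p)%:R
              + 1 / (d * v * p)%:R :> rat)
  <-> (4 * d * u * v = p + u + v)%N.
Proof.
move=> p0 d0 u0 v0.
have nz n : (0 < n)%N -> n%:R != 0 :> rat by rewrite pnatr_eq0 lt0n.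
have [pz dz uz vz] : [/\ p%:R != 0 :> rat, d%:R != 0 :> rat,
    u%:R != 0 :> rat & v%:R != 0 :> rat] by split; exact: nz.
set L := 4 / p%:R; set M := 1 / _ + _ + _.
(* [N] is a common multiple of the denominators. Since it is nonzero, multiplying by it is
   injective, which gives both directions at once. *)
set N := (d * u * v * p)%:R : rat.
have Nz : N != 0 by rewrite nz // !muln_gt0 d0 u0 v0 p0.
have LN : L * N = (4 * d * u * v)%:R.
  by rewrite /L /N !natrM; field.
have MN : M * N = (p + u + v)%:R.
  by rewrite /M /N !natrD !natrM; field; rewrite dz uz vz pz.
split=> [LM | E]; first by apply/eqP; rewrite -(eqr_nat rat) -LN -MN LM.
by apply: (mulIf Nz); rewrite LN MN E.
Qed.

Lemma typeB_factor_lt (p d u v : nat) :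
  (0 < d)%N -> (0 < u)%N -> (0 < v)%N -> (4 * d * u * v = p + u + v)%N ->
  [/\ (d < p)%N, (u < p)%N & (v < p)%N].
Proof.
move=> d0 u0 v0 E.
have uv : (0 < u * v)%N by rewrite muln_gt0 u0.
(* With [u * v] and [d * (u * v)] taken as atoms, these bounds make each of the three contradictions
   linear. *)
have duv : (u * v <= d * (u * v))%N by rewrite leq_pmull.
have u_le : (u <= u * v)%N by rewrite leq_pmulr.
have v_le : (v <= u * v)%N by rewrite leq_pmull.
have d_le : (d <= d * (u * v))%N by rewrite leq_pmulr.
by split; rewrite ltnNge; apply/negP=> le_p; lia.
Qed.

Lemma typeB_congruenceP (p d n : nat) : (0 < p)%N -> (0 < d)%N -> (0 < n)%N ->
  (p%:Z = - n%:Z %[mod 4 * d%:Z * n%:Z - 1])%Z <->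
  exists2 v : nat, (0 < v)%N & (4 * d * n * v = p + n + v)%N.
Proof.
move=> p0 d0 n0; split=> [/eqP | [v v0 E]].
  rewrite eqz_mod_dvd opprK => /dvdzP[q Eq].
  (* A positive modulus and [p + n > 0] force the integer quotient [q] to be positive, hence a
     natural number. *)
  have m0 : 0 < 4 * d%:Z * n%:Z - 1 by nia.
  have q0 : 0 < q by rewrite -(pmulr_lgt0 _ m0) -Eq; lia.
  case: q q0 Eq => // v v0 Eq; exists v; first by lia.
  by nia.
by apply/eqP; rewrite eqz_mod_dvd opprK; apply/dvdzP; exists v%:Z; nia.
Qed.

Theorem theorem4 (p d : nat) (p_prime : prime p) (d_gt0 : (0 < d)%N) :
  ((exists u v : nat,
      [/\ (0 < u)%N, (0 < v)%N
        & 4 / p%:R = 1 / (d * u * v)%:R + 1 / (d * u * p)%:R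
                     + 1 / (d * v * p)%:R :> rat])
   <->
   (exists n : nat,
      (0 < n)%N /\
      (p%:Z = - n%:Z %[mod 4 * d%:Z * n%:Z - 1])%Z))
  /\
  (forall u v : nat,
     (0 < u)%N -> (0 < v)%N ->
     4 / p%:R = 1 / (d * u * v)%:R + 1 / (d * u * p)%:R
                + 1 / (d * v * p)%:R :> rat ->
     typeII p ((d * u * v)%N, (d * u * p)%N, (d * v * p)%N)).
Proof.
have p0 := prime_gt0 p_prime.
split; first split.
- case=> u [v [u0 v0 /typeB_equationE E]].
  exists u; split=> //; apply/typeB_congruenceP => //.
  by exists v => //; exact: E.
- case=> n [n0 /typeB_congruenceP[]// v v0 E].
  by exists n, v; split=> //; apply/typeB_equationE.
move=> u v u0 v0 Eq; split; first by split; rewrite ?muln_gt0 ?d_gt0 ?u0 ?v0.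
have /typeB_factor_lt[]// := (typeB_equationE _ _ _ _ p0 d_gt0 u0 v0).1 Eq.
move=> dp up vp.
have co m : (0 < m)%N -> (m < p)%N -> coprime p m.
  by move=> m0 mp; rewrite prime_coprime // gtnNdvd.
have duv : gcdn p (d * u * v) = 1%N.
  by apply/eqP; rewrite -/(coprime _ _) !coprimeMr !co.
(* The least entry is [d * u * v] in either case, as [u] and [v] are below [p]; the order of the two
   multiples of [p] is that of [u] and [v]. *)
have [uv | /ltnW vu] := leqP u v.
  exists (d * u * v)%N, (d * u * p)%N, (d * v * p)%N.
  by split; rewrite ?dvdn_mull //= leq_mul2l ltnW ?orbT //= leq_mul2r leq_mul2l uv !orbT.
exists (d * u * v)%N, (d * v * p)%N, (d * u * p)%N; split; rewrite ?dvdn_mull //=.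
  by rewrite perm_cons (perm_catC [:: _] [:: _]).
by rewrite mulnAC leq_mul2l ltnW ?orbT //= leq_mul2r leq_mul2l vu !orbT.
Qed.
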